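(* Let $G$ be a finitely generated group equipped with a word length function $|\cdot|$ (with respect to a finite generating set). Then $G$ has property A (equivalently, $G$ is exact) if and only if for every $\varepsilon>0$ there exist a uniformly bounded representation $\pi$ of $G$ on a Hilbert space $H$, a vector $v\in H$ and a constant $S>0$ such that (1) $\Vert \pi_g v\Vert=1$ for all $g\in G$; (2) $\vert 1-\langle \pi_g v,\pi_h v\rangle\vert\le\varepsilon$ for all $g,h\in G$ with $\vert g^{-1}h\vert\le 1$; (3) $\langle \pi_g v,\pi_h v\rangle=0$ for all $g,h\in G$ with $\vert g^{-1}h\vert\ge S$.
   Context: Hilbert spaces are complex. A representation $\pi$ of a group $G$ on a Hilbert space $H$ is a homomorphism $g\mapsto \pi_g$ from $G$ to the group of bounded invertible linear operators on $H$; it is uniformly bounded if $\sup_{g\in G}\Vert \pi_g\Vert_{B(H)}<\infty$. A Hermitian kernel on a set $X$ is a function $K:X\times X\to\mathbb{C}$ with $K(x,y)=\overline{K(y,x)}$ for all $x,y$; it is positive definite if $\sum_{x,y\in X}K(x,y)f(x)\overline{f(y)}\ge 0$ for every finitely supported $f:X\to\mathbb{C}$. Property A (the following characterization is used as the definition): a discrete metric space $(X,d)$ has property A if for every $R,\varepsilon>0$ there exist a Hermitian positive definite kernel $K:X\times X\to[0,1]$ and $S>0$ such that (i) $K(x,x)=1$ for every $x\in X$; (ii) $|1-K(x,y)|\le\varepsilon$ if $d(x,y)\le R$; (iii) $K(x,y)=0$ if $d(x,y)\ge S$. A finitely generated group $G$ has property A if the metric space $G$ with the word metric $d(g,h)=|g^{-1}h|$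 has property A. For groups, property A is equivalent to exactness. *)

(* Defs.v *)
From HB Require Import structures.
From mathcomp Require Import all_boot all_order all_algebra all_fingroup.
From mathcomp Require Import sesquilinear complex.
From mathcomp Require Import all_classical all_reals.
From mathcomp Require Import ereal topology normedtype.

Set Implicit Arguments.
Unset Strict Implicit.
Unset Printing Implicit Defensive.

Import Order.TTheory GRing.Theory Num.Theory.
Import numFieldNormedType.Exports.

Local Open Scope classical_set_scope.
Local Open Scope ring_scope.

(* [groupType] is the structure of arbitrary, possibly infinite, groups. *)

Section WordLength.
Variables (G : groupType) (S : set G).

Definition is_word (w : seq G) : Prop :=
  forall s, s \in w -> S s \/ S (s^-1)%g.

Definition word_of_size (g : G) (n : nat) : Prop :=
  exists w : seq G,
    [/\ size w = n, is_word w & (\big[*%g/1%g]_(s <- w) s)%g = g].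

Definition generates : Prop := forall g : G, exists n, word_of_size g n.

Lemma word_exists (hS : generates) g : exists n, `[< word_of_size g n >].
Proof. by have [n gn] := hS g; exists n; apply/asboolP. Qed.

Definition word_length (hS : generates) (g : G) : nat :=
  ex_minn (word_exists hS g).

Lemma word_lengthP (hS : generates) g : word_of_size g (word_length hS g).
Proof. by rewrite /word_length; case: ex_minnP => n /asboolP. Qed.

Lemma word_length_min (hS : generates) g n :
  word_of_size g n -> (word_length hS g <= n)%N.
Proof.
by rewrite /word_length; case: ex_minnP => m _ mmin gn; apply/mmin/asboolP.
Qed.

Lemma word_length1 (hS : generates) : word_length hS 1%g = 0%N.
Proof.
apply/eqP; rewrite -leqn0; apply: word_length_min.
by exists [::]; split; rewrite ?big_nil.
Qed.

Lemma word_length_eq0 (hS : generates) g : word_length hS g = 0%N -> g = 1%g.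
Proof.
move=> g0; have [w [/eqP]] := word_lengthP hS g.
by rewrite g0 size_eq0 => /eqP-> _ <-; rewrite big_nil.
Qed.

Lemma word_lengthM (hS : generates) g h :
  (word_length hS (g * h)%g <= word_length hS g + word_length hS h)%N.
Proof.
have [w [<- wS <-]] := word_lengthP hS g.
have [w' [<- w'S <-]] := word_lengthP hS h.
apply: word_length_min; exists (w ++ w'); split; first by rewrite size_cat.
- by move=> s; rewrite mem_cat => /orP[/wS|/w'S].
- by rewrite big_cat.
Qed.

Lemma word_lengthV_le (hS : generates) g :
  (word_length hS (g^-1)%g <= word_length hS g)%N.
Proof.
have [w [sw wS wg]] := word_lengthP hS g.
apply: word_length_min; exists (rev [seq (s^-1)%g | s <- w]); split.
- by rewrite size_rev size_map.
- move=> s; rewrite mem_rev => /mapP[t /wS tS ->].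
  by rewrite invgK; case: tS; [right|left].
- by rewrite -map_rev big_map prodgV revK wg.
Qed.

Lemma word_lengthV (hS : generates) g :
  word_length hS (g^-1)%g = word_length hS g.
Proof.
apply/eqP; rewrite eqn_leq word_lengthV_le /=.
by rewrite -{1}[g]invgK word_lengthV_le.
Qed.

End WordLength.

(* Alias of G carrying the word metric d(g,h) = |g^-1 h|; it depends on the
   generating set through hS. *)
Definition word_space (R : realType) (G : groupType) (S : set G)
  (hS : generates S) : Type := G.

Section WordMetric.
Variables (R : realType) (G : groupType) (S : set G) (hS : generates S).

HB.instance Definition _ := Choice.copy (word_space R hS) G.

Definition word_dist (g h : word_space R hS) : R :=
  (word_length hS ((g : G)^-1 * (h : G))%g)%:R.

Lemma word_distxx g : word_dist g g = 0.
Proof. by rewrite /word_dist mulVg word_length1. Qed.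

Lemma word_dist_eq0 g h : word_dist g h = 0 -> g = h.
Proof.
rewrite /word_dist => /eqP; rewrite pnatr_eq0 => /eqP/word_length_eq0 gh1.
by rewrite -[RHS](mulKVg (g : G)) gh1 mulg1.
Qed.

Lemma word_dist_sym g h : word_dist g h = word_dist h g.
Proof. by rewrite /word_dist -word_lengthV invgM invgK. Qed.

Lemma word_dist_triangle (h g k : word_space R hS) :
  word_dist g k <= word_dist g h + word_dist h k.
Proof.
rewrite /word_dist -natrD ler_nat.
rewrite (_ : (g : G)^-1 * (k : G) =
             ((g : G)^-1 * (h : G)) * ((h : G)^-1 * (k : G)))%g.
  exact: word_lengthM.
by rewrite !mulgA mulgK.
Qed.

HB.instance Definition _ := @isMetric.Build R (word_space R hS) word_dist
  word_distxx word_dist_eq0 word_dist_sym word_dist_triangle.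

Lemma mdist_wordE (g h : word_space R hS) :
  mdist g h = (word_length hS ((g : G)^-1 * (h : G))%g)%:R :> R.
Proof. by []. Qed.

End WordMetric.

(* [R[i]] is the field of complex numbers, [z^*] conjugation.  Its order is the
   partial one for which [a <= b] forces [b - a] to be real; in particular
   [0 <= z] means that z is real and nonnegative. *)

Section Kernels.
Variables (R : realType) (X : choiceType).

Definition hermitian_kernel (K : X -> X -> R[i]) : Prop :=
  forall x y, K x y = ((K y x)^*)%R.

(* The [\sum_(x \in setT)] are sums over the support, finite because f has
   finite support. *)
Definition positive_definite_kernel (K : X -> X -> R[i]) : Prop :=
  forall f : X -> R[i], finite_set [set x | f x != 0] ->
    0 <= \sum_(x \in [set: X]) \sum_(y \in [set: X])
           K x y * f x * ((f y)^*)%R.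

End Kernels.

Definition property_A (R : realType) (X : metricType R) : Prop :=
  forall r eps : R, 0 < r -> 0 < eps ->
  exists (K : X -> X -> R[i]) (S : R),
    [/\ hermitian_kernel K, positive_definite_kernel K,
        forall x y, 0 <= K x y <= 1 & 0 < S] /\
    [/\ forall x, K x x = 1,
        forall x y, mdist x y <= r -> `|1 - K x y| <= (eps%:C)%C &
        forall x y, S <= mdist x y -> K x y = 0].

Definition group_property_A (R : realType) (G : groupType) (S : set G)
  (hS : generates S) : Prop := property_A (word_space R hS).

(* The inner product is linear in its first argument and conjugate-linear in
   the second one; norms of vectors are (real) elements of R[i]. *)
Record hilbertSpace (R : realType) := HilbertSpace {
  hilbert_sort :> completeNormedModType R[i] ;
  inner : {dot hilbert_sort for Num.conj} ;
  sqr_norm_inner : forall v : hilbert_sort, `|v| ^+ 2 = inner v v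
}.

Section Representations.
Variable R : realType.

Definition op_norm (H : hilbertSpace R) (T : {linear H -> H}) : \bar R :=
  ereal_sup [set (complex.Re `|T v|)%:E | v in [set v : H | `|v| <= 1]].

Definition bounded_operator (H : hilbertSpace R) (T : {linear H -> H}) : Prop :=
  (op_norm T < +oo)%E.

Definition bounded_invertible (H : hilbertSpace R) (T : {linear H -> H}) : Prop :=
  bounded_operator T /\
  exists T' : {linear H -> H},
    [/\ bounded_operator T', cancel T T' & cancel T' T].

(* [rep_op 1 = id] is not required as it follows: [rep_op 1] is idempotent and
   invertible. *)
Record representation (G : groupType) (H : hilbertSpace R) := Representation {
  rep_op :> G -> {linear H -> H} ;
  rep_invertible : forall g, bounded_invertible (rep_op g) ;
  repM : forall (g h : G) (v : H), rep_op (g * h)%g v = rep_op g (rep_op h v)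
}.

Definition uniformly_bounded (G : groupType) (H : hilbertSpace R)
  (pi : representation G H) : Prop :=
  (ereal_sup (range (fun g => op_norm (pi g))) < +oo)%E.

End Representations.

(* Main.v *)
(* If G has property A with kernel K of finite propagation, then for small c > 0
   the kernel k = (K + c delta) / (1 + c) defines on l^2(G) an inner product
   <f, f'> = sum_{x, y} k(x, y) f(x) conj(f'(y)) equivalent to the standard one:
   c delta bounds it from below, finite propagation (Schur's test) from above.
   Left translations are isometries of l^2(G), hence uniformly bounded for this
   inner product, and the matrix coefficients of delta_1 are the values of k.
   Conversely, K(g, h) = |<pi_g v, pi_h v>|^2 is a Schur product of Gram kernels,
   hence positive definite, and |g^-1 h| steps of length at most eta lead from
   pi_g v to pi_h v. *)

Require Import Defs.
From HB Require Import structures.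
From mathcomp Require Import all_boot all_order all_algebra all_fingroup.
From mathcomp Require Import sesquilinear complex finmap.
From mathcomp Require Import all_classical all_reals.
From mathcomp Require Import ereal topology normedtype.
From mathcomp Require Import ring.

Set Implicit Arguments.
Unset Strict Implicit.
Unset Printing Implicit Defensive.

Import Order.TTheory GRing.Theory Num.Theory.
Import numFieldNormedType.Exports.

Local Open Scope classical_set_scope.
Local Open Scope ring_scope.

(** * Componentwise limits of complex functions along a proper filter *)

Section ComplexLimits.
Variables (R : realType) (T : Type) (U : set_system T).
Context {FU : ProperFilter U}.
Implicit Types (b : T -> R[i]) (z w : R[i]).

(* Componentwise convergence avoids any appeal to the topology of R[i]. *)
Definition ccvg b z :=
  (fun t => complex.Re (b t)) @ U --> complex.Re z /\
  (fun t => complex.Im (b t)) @ U --> complex.Im z.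

Lemma ccvg_unique b z w : ccvg b z -> ccvg b w -> z = w.
Proof.
move=> [bz1 bz2] [bw1 bw2]; apply/eqP; rewrite eq_complex.
by rewrite (cvg_unique _ bz1 bw1)// (cvg_unique _ bz2 bw2)// !eqxx.
Qed.

Lemma ccvg_near b b' z : (\forall t \near U, b t = b' t) ->
  ccvg b z -> ccvg b' z.
Proof.
move=> bb' [bz1 bz2]; split.
- apply: cvg_trans bz1; apply: near_eq_cvg.
  by near=> t; congr complex.Re; near: t.
- apply: cvg_trans bz2; apply: near_eq_cvg.
  by near=> t; congr complex.Im; near: t.
Unshelve. all: by end_near. Qed.

Lemma ccvg_cst z : ccvg (fun=> z) z.
Proof. by split; exact: cvg_cst. Qed.

Lemma ccvgD b b' z z' : ccvg b z -> ccvg b' z' ->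
  ccvg (fun t => b t + b' t) (z + z').
Proof.
move=> [bz1 bz2] [bz1' bz2']; split.
- rewrite raddfD (_ : (fun t => _) =
    (fun t => complex.Re (b t) + complex.Re (b' t))); first exact: cvgD.
  by apply/funext => t; rewrite raddfD.
- rewrite raddfD (_ : (fun t => _) =
    (fun t => complex.Im (b t) + complex.Im (b' t))); first exact: cvgD.
  by apply/funext => t; rewrite raddfD.
Qed.

Lemma ccvgM b b' z z' : ccvg b z -> ccvg b' z' ->
  ccvg (fun t => b t * b' t) (z * z').
Proof.
case: z z' => [z1 z2] [z1' z2'] [/= bz1 bz2] [/= bz1' bz2']; split=> /=.
- rewrite (_ : (fun t => _) = (fun t => complex.Re (b t) * complex.Re (b' t) -
      complex.Im (b t) * complex.Im (b' t))); first by apply: cvgB; apply: cvgM.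
  by apply/funext => t; case: (b t) => ? ?; case: (b' t).
- rewrite (_ : (fun t => _) = (fun t => complex.Re (b t) * complex.Im (b' t) +
      complex.Im (b t) * complex.Re (b' t))); first by apply: cvgD; apply: cvgM.
  by apply/funext => t; case: (b t) => ? ?; case: (b' t).
Qed.

Lemma ccvgZ a b z : ccvg b z -> ccvg (fun t => a * b t) (a * z).
Proof. exact/ccvgM/ccvg_cst. Qed.

Lemma ccvg_sum (I : Type) (s : seq I) (b : I -> T -> R[i]) (z : I -> R[i]) :
  (forall i, ccvg (b i) (z i)) ->
  ccvg (fun t => \sum_(i <- s) b i t) (\sum_(i <- s) z i).
Proof.
move=> bz; elim: s => [|i s IH].
  rewrite big_nil (_ : (fun t => _) = fun=> 0); first exact: ccvg_cst.
  by apply/funext => t; rewrite big_nil.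
rewrite big_cons (_ : (fun t => _) = fun t => b i t + \sum_(j <- s) b j t).
  exact: ccvgD.
by apply/funext => t; rewrite big_cons.
Qed.

Lemma ccvg_conj b z : ccvg b z -> ccvg (fun t => (b t)^*) z^*.
Proof.
move=> [bz1 bz2]; split.
- case: z bz1 bz2 => z1 z2 /= bz1 _.
  rewrite (_ : (fun t => _) = (fun t => complex.Re (b t)))//.
  by apply/funext => t; case: (b t).
- case: z bz1 bz2 => z1 z2 /= _ bz2.
  rewrite (_ : (fun t => _) = (fun t => - complex.Im (b t))); first exact: cvgN.
  by apply/funext => t; case: (b t).
Qed.

(** The order on [R[i]] forces [b t] and [w] to share their imaginary part near [U], so this part is
    eventually constant; the real parts pass to the limit as usual. *)
Lemma ccvg_ge b z w : (\forall t \near U, w <= b t) -> ccvg b z -> w <= z.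
Proof.
move=> wb [bz1 bz2]; rewrite lecE; apply/andP; split.
- rewrite (_ : complex.Im z = complex.Im w)//.
  apply: (cvg_unique _ bz2) => //; apply: cvg_near_cst.
  by apply: filterS wb => t /=; rewrite lecE => /andP[/eqP].
- apply: (cvgr_to_ge bz1).
  by apply: filterS wb => t /=; rewrite lecE => /andP[].
Qed.

Lemma ccvg_le b z w : (\forall t \near U, b t <= w) -> ccvg b z -> z <= w.
Proof.
move=> wb /(ccvgZ (-1)) bz; rewrite -lerN2 -[- z]mulN1r.
by apply: ccvg_ge bz; apply: filterS wb => t; rewrite mulN1r lerN2.
Qed.

End ComplexLimits.

(** * Convergence of bounded functions along ultrafilters *)

Lemma fmap_ultra (T V : Type) (U : set_system T) (f : T -> V) :
  UltraFilter U -> UltraFilter (f @ U).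
Proof.
move=> FU; split=> [|G PG sG]; first exact: fmap_proper_filter.
apply/seteqP; split=> // A GA; have [//|UnA] := in_ultra_setVsetC (f @^-1` A) FU.
have /filterI/(_ GA) : G (~` A) by apply: sG.
by rewrite setICl => /filter_ex[].
Qed.

(** The image of [U] is an ultrafilter containing the compact segment from [- B] to [B], hence it
    converges there. *)
Lemma ultra_bounded_cvg (R : realType) (T : Type) (U : set_system T)
    (FU : UltraFilter U) (b : T -> R) (B : R) :
  (forall t, `|b t| <= B) -> cvg (b @ U).
Proof.
move=> bB; have := @segment_compact R (- B) B; rewrite compact_ultra.
move=> /(_ (b @ U) (fmap_ultra b FU))[].
- have : \forall t \near U, b t \in `[- B, B].
    by near=> t; rewrite in_itv/= -ler_norml.
  exact.
- by move=> z [_ bz]; apply/cvg_ex; exists z.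
Unshelve. all: by end_near. Qed.

Lemma ultra_bounded_ccvg (R : realType) (T : Type) (U : set_system T)
    (FU : UltraFilter U) (b : T -> R[i]) (B : R) :
  (forall t, `|b t| <= B%:C%C) -> exists z, ccvg U b z.
Proof.
move=> bB; have ReB t : `|complex.Re (b t)| <= B.
  by rewrite -lecR (le_trans _ (bB t))// normc_ge_Re.
have ImB t : `|complex.Im (b t)| <= B.
  (* Up to sign, the imaginary part is the real part of ['i * b t], which has the same modulus as
     [b t]. *)
  rewrite -lecR (le_trans _ (bB t))// -normrN -ReiNIm.
  rewrite (le_trans (normc_ge_Re _))// normrM complexiE normCi mulr1.
  exact: lexx.
exists (Complex (lim ((fun t => complex.Re (b t)) @ U))
                (lim ((fun t => complex.Im (b t)) @ U))).
by split; apply: ultra_bounded_cvg; [exact: ReB|exact: ImB].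
Qed.

(** * Square-summable functions and finite sesquilinear forms *)

Section SquareSummable.
Variables (R : realType) (X : choiceType).
Local Notation C := R[i].
Implicit Types (f g : X -> C) (F : {fset X}).

Definition energy f F : C := \sum_(x <- F) `|f x| ^+ 2.

Lemma energy_ge0 f F : 0 <= energy f F.
Proof. by apply: sumr_ge0 => x _; rewrite exprn_ge0. Qed.

Lemma energy_subset f F F' : {subset F <= F'} -> energy f F <= energy f F'.
Proof.
move=> FF'; rewrite /energy [leRHS](bigID (mem F))/= -[leLHS]addr0.
rewrite lerD ?sumr_ge0//.
rewrite -[leRHS]big_filter (perm_big [seq x <- F' | x \in F])//.
apply: uniq_perm; rewrite ?filter_uniq ?fset_uniq// => x.
by rewrite mem_filter; apply/idP/andP => [xF|[]//]; split=> //; exact: FF'.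
Qed.

(** Parallelogram law: the difference of the two sides is the energy of [f - g]. *)
Lemma energyD f g F : energy (f \+ g) F <= 2 * energy f F + 2 * energy g F.
Proof.
rewrite /energy !mulr_sumr -big_split/=; apply: ler_sum => x _.
have := exprn_ge0 2 (normr_ge0 (f x - g x)).
rewrite !normCK !rmorphD rmorphN/= => fg.
rewrite -subr_ge0 (le_trans fg)// le_eqVlt; apply/orP; left; apply/eqP.
ring.
Qed.

Lemma energyZ a f F : energy (fun x => a * f x) F = `|a| ^+ 2 * energy f F.
Proof.
by rewrite /energy mulr_sumr; apply: eq_bigr => x _; rewrite normrM exprMn.
Qed.

(** Bounding the sums over all finite subsets describes l^2 without infinite sums, on a set of any
    cardinality. *)
Definition square_summable f := exists B : C, forall F, energy f F <= B.

Definition l2_pred : {pred X -> C} := fun f => `[< square_summable f >].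

Lemma l2_pred_submod : submod_closed l2_pred.
Proof.
split=> [|a f g /asboolP[B fB] /asboolP[D gD]]; apply/asboolP.
- by exists 0 => F; rewrite /energy big1// => x _; rewrite normr0 expr0n.
- exists (2 * (`|a| ^+ 2 * B) + 2 * D) => F.
  rewrite (le_trans (energyD (fun x => a * f x) g F))// energyZ.
  by rewrite lerD// !ler_wpM2l// ?exprn_ge0.
Qed.

HB.instance Definition _ := GRing.isSubmodClosed.Build C (X -> C) l2_pred
  l2_pred_submod.

Record l2 := L2 { l2fun :> X -> C ; l2funP : l2fun \in l2_pred }.

HB.instance Definition _ := [isSub for l2fun].
HB.instance Definition _ := [Choice of l2 by <:].
HB.instance Definition _ := [SubChoice_isSubLmodule of l2 by <:].

Lemma l2P (f g : l2) : (forall x, f x = g x) -> f = g.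
Proof. by move=> fg; apply/val_inj/funext. Qed.

Lemma l2_bound (f : l2) : exists B : C, forall F, energy f F <= B.
Proof. by have /asboolP := l2funP f. Qed.

Definition finite_form (k : X -> X -> C) (s : seq X) f g : C :=
  \sum_(x <- s) \sum_(y <- s) k x y * f x * (g y)^*.

Lemma finite_formDl k s f f' g : finite_form k s (fun x => f x + f' x) g =
  finite_form k s f g + finite_form k s f' g.
Proof.
rewrite /finite_form -big_split; apply: eq_bigr => x _.
rewrite -big_split; apply: eq_bigr => y _ /=; ring.
Qed.

Lemma finite_formZl k s a f g :
  finite_form k s (fun x => a * f x) g = a * finite_form k s f g.
Proof.
rewrite /finite_form mulr_sumr; apply: eq_bigr => x _.
by rewrite mulr_sumr; apply: eq_bigr => y _; ring.
Qed.

Lemma finite_form_conj k s f g : hermitian_kernel k ->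
  (finite_form k s f g)^* = finite_form k s g f.
Proof.
move=> kH; rewrite /finite_form rmorph_sum exchange_big/=.
apply: eq_bigr => x _; rewrite rmorph_sum; apply: eq_bigr => y _.
by rewrite !rmorphM/= conjCK -kH; ring.
Qed.

(** Schur's test: [|f x| * |g y|] is at most the mean of the two squares. Summing over [y] first
    handles the [f] half; exchanging the sums handles the [g] half, where Hermitian symmetry turns
    column sums into row sums. *)
Lemma finite_form_schur k M f g F : hermitian_kernel k ->
  (forall x F, \sum_(y <- F) `|k x y| <= M) ->
  `|finite_form k F f g| <= M / 2 * (energy f F + energy g F).
Proof.
move=> kH kM; pose h (u : X -> C) x y := `|k x y| * (`|u x| ^+ 2 / 2).
have hM u : \sum_(x <- F) \sum_(y <- F) h u x y <= M / 2 * energy u F.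
  rewrite /energy mulr_sumr; apply: ler_sum => x _.
  by rewrite -mulr_suml -[leRHS]mulrA [2^-1 * _]mulrC ler_wpM2r// divr_ge0// exprn_ge0.
rewrite mulrDr (le_trans _ (lerD (hM f) (hM g)))//.
rewrite [X in _ + X]exchange_big -big_split/=.
rewrite (le_trans (ler_norm_sum _ _ _))//; apply: ler_sum => x _.
rewrite -big_split (le_trans (ler_norm_sum _ _ _))//; apply: ler_sum => y _.
rewrite /h (kH y x) norm_conjC/= -mulrDr -mulrA normrM ler_wpM2l//.
rewrite normrM norm_conjC -mulrDl.
by have [] := real_leif_mean_square (normr_real (f x)) (normr_real (g y)).
Qed.

End SquareSummable.

(** * Cauchy-Schwarz and triangle inequalities *)

Section DotProducts.
Variables (C : numClosedFieldType) (U : lmodType C).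
Variable form : {dot U for @Num.conj C}.
Local Notation "''[' u , v ]" := (form u v) : ring_scope.
Local Notation "''[' u ]" := '[u, u] : ring_scope.

(** Pythagoras: [u] is the sum of its projection [a *: v] and a vector orthogonal to [v]. *)
Lemma dot_CauchySchwarz u v : `|'[u, v]| ^+ 2 <= '[u] * '[v].
Proof.
have [->|v0] := eqVneq v 0; first by rewrite !linear0r normr0 expr0n mulr0.
pose a := '[u, v] / '[v]; have vN0 : '[v] != 0 by rewrite dnorm_eq0.
have uv : '[u - a *: v, v] = 0.
  by rewrite linearBl linearZl_LR/= divfK// subrr.
have -> : '[u] = '[u - a *: v] + `|a| ^+ 2 * '[v].
  by rewrite -dnormZ -hnormDd ?subrK// linearZr_LR/= uv mulr0.
rewrite mulrDl -mulrA -expr2 -exprMn.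
rewrite -[X in (_ * X) ^+ 2](ger0_norm (dnorm_ge0 form v)) -normrM divfK//.
by rewrite lerDr mulr_ge0 ?dnorm_ge0.
Qed.

Lemma dot_CauchySchwarz_sqrt u v : `|'[u, v]| <= sqrtC '[u] * sqrtC '[v].
Proof.
rewrite -(ler_pXn2r (ltn0Sn 1)) ?nnegrE ?mulr_ge0 ?sqrtC_ge0 ?dnorm_ge0//.
by rewrite exprMn !sqrtCK dot_CauchySchwarz.
Qed.

Lemma dot_triangle u v : sqrtC '[u + v] <= sqrtC '[u] + sqrtC '[v].
Proof.
rewrite -(ler_pXn2r (ltn0Sn 1)) ?nnegrE ?addr_ge0 ?sqrtC_ge0 ?dnorm_ge0//.
rewrite sqrrD !sqrtCK dnormD [leRHS]addrAC lerD2l.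
rewrite -[_ + _](divfK (negbT (pnatr_eq0 C 2))) mulr_natr.
rewrite lerMn2r/= (le_trans _ (dot_CauchySchwarz_sqrt u v))//.
by rewrite -ReE; case: (leif_Re_Creal '[u, v]).
Qed.

End DotProducts.

(** * An ultrafilter of finite subsets, ordered by inclusion *)

Section FiniteSubsets.
Variable X : choiceType.

Definition fset_filter : set_system {fset X} :=
  filter_from setT (fun A : {fset X} => [set B : {fset X} | {subset A <= B}]).

Lemma fset_filter_proper : ProperFilter fset_filter.
Proof.
apply: filter_from_proper => [|A _]; last by exists A.
apply: filter_fromT_filter => [|A B]; first by exists fset0.
exists (A `|` B)%fset => D ABD.
by split=> x xAB; apply: ABD; rewrite in_fsetU xAB ?orbT.
Qed.

(* Limits of bounded functions along an ultrafilter always exist, so that the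
   form below needs no summability argument. *)
Definition fset_ultrafilter : set_system {fset X} :=
  projT1 (cid (ultraFilterLemma fset_filter_proper)).

#[global] Instance fset_ultrafilterP : UltraFilter fset_ultrafilter.
Proof. by rewrite /fset_ultrafilter; case: cid => ? []. Qed.

Lemma near_fset_ultrafilter (A : {fset X}) :
  \forall F \near fset_ultrafilter, {subset A <= F}.
Proof.
by rewrite /fset_ultrafilter; case: cid => U [_ +] /=; apply; exists A.
Qed.

End FiniteSubsets.

(** * The inner product on l^2 defined by a coercive kernel *)

Record coercive_kernel (R : realType) (X : choiceType) := CoerciveKernel {
  kernel_fun :> X -> X -> R[i] ;
  kernel_lower : R[i] ;
  kernel_upper : R[i] ;
  kernel_lower_gt0 : 0 < kernel_lower ;
  kernel_hermitian : hermitian_kernel kernel_fun ;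
  kernel_coercive : forall (f : X -> R[i]) (F : {fset X}),
    kernel_lower * energy f F <= finite_form kernel_fun F f f ;
  kernel_row_sum : forall (x : X) (F : {fset X}),
    \sum_(y <- F) `|kernel_fun x y| <= kernel_upper
}.

(** An alias indexed by [k], since the norm put on l^2 depends on the kernel. *)
Definition kernel_l2 (R : realType) (X : choiceType)
  (k : coercive_kernel R X) : Type := l2 R X.

Section KernelSpace.
Variables (R : realType) (X : choiceType) (k : coercive_kernel R X).
Local Notation C := R[i].
Local Notation H := (kernel_l2 k).
Local Notation lo := (kernel_lower k).
Local Notation hi := (kernel_upper k).

HB.instance Definition _ := GRing.Lmodule.copy H (l2 R X).

(* [hi] itself may be negative when X is empty. *)
Lemma kernel_form_bound (f g : X -> C) (F : {fset X}) :
  `|finite_form k F f g| <= `|hi| / 2 * (energy f F + energy g F).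
Proof.
apply: finite_form_schur => [|x E]; first exact: kernel_hermitian.
rewrite (le_trans (kernel_row_sum k x E))// ger0_norm//.
by have := kernel_row_sum k x fset0; rewrite big_seq_fset0.
Qed.

(** The default 0 of [xget] would be returned only without a limit; [kdotP] excludes this, as
    Schur's test bounds the finite forms. *)
Definition kdot (f g : H) : C :=
  xget 0 (ccvg (@fset_ultrafilter X) (fun F : {fset X} => finite_form k F f g)).

Lemma kdotP (f g : H) :
  ccvg (@fset_ultrafilter X) (fun F : {fset X} => finite_form k F f g) (kdot f g).
Proof.
apply: xgetPex.
have [B fB] := l2_bound f; have [D gD] := l2_bound g.
pose b := `|hi| / 2 * (B + D).
have hb (F : {fset X}) : `|finite_form k F f g| <= b.
  rewrite (le_trans (kernel_form_bound f g F))//.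
  by rewrite ler_wpM2l ?divr_ge0// lerD.
have b0 : 0 <= b by rewrite (le_trans _ (hb fset0)).
apply: (@ultra_bounded_ccvg _ _ _ _ _ (complex.Re b)) => F.
by rewrite RRe_real ?ger0_real.
Qed.

Lemma kdot_unique (f g : H) z :
  ccvg (@fset_ultrafilter X) (fun F : {fset X} => finite_form k F f g) z -> kdot f g = z.
Proof. exact: (ccvg_unique (kdotP f g)). Qed.

Lemma kdotDl (f f' g : H) : kdot (f + f') g = kdot f g + kdot f' g.
Proof.
apply: kdot_unique; apply: ccvg_near (ccvgD (kdotP f g) (kdotP f' g)).
by near=> F; rewrite -finite_formDl.
Unshelve. all: by end_near. Qed.

Lemma kdotZl a (f g : H) : kdot (a *: f) g = a * kdot f g.
Proof.
apply: kdot_unique; apply: ccvg_near (ccvgZ a (kdotP f g)).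
by near=> F; rewrite -finite_formZl.
Unshelve. all: by end_near. Qed.

Lemma kdotC (f g : H) : kdot f g = (kdot g f)^*.
Proof.
apply: kdot_unique; apply: ccvg_near (ccvg_conj (kdotP g f)).
near=> F; exact/finite_form_conj/kernel_hermitian.
Unshelve. all: by end_near. Qed.

(** Coercivity on any finite set containing [F] already gives this bound, because energy grows with
    the set; such sets are near the ultrafilter. *)
Lemma kdot_ge (f : H) F : lo * energy f F <= kdot f f.
Proof.
apply: ccvg_ge (kdotP f f); near=> F'.
rewrite (le_trans _ (kernel_coercive _ _ _))// ler_wpM2l//.
  exact/ltW/kernel_lower_gt0.
by apply: energy_subset; near: F'; exact: near_fset_ultrafilter.
Unshelve. all: by end_near. Qed.

(** Schur's test with [g = f]; the finite forms are nonnegative by coercivity, so they equal their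
    moduli. *)
Lemma kdot_le (f : H) B : (forall F, energy f F <= B) ->
  kdot f f <= `|hi| * B.
Proof.
move=> fB; apply: ccvg_le (kdotP f f); near=> F.
have fF0 : 0 <= finite_form k F f f.
  rewrite (le_trans _ (kernel_coercive _ _ _))// mulr_ge0// ?energy_ge0//.
  exact/ltW/kernel_lower_gt0.
rewrite -(ger0_norm fF0).
rewrite (le_trans (kernel_form_bound f f F))//.
rewrite -mulr2n mulrnAr -mulrnAl -(mulr_natr (_ / _)) divfK ?pnatr_eq0//.
by rewrite ler_wpM2l.
Unshelve. all: by end_near. Qed.

Lemma normsq_le_kdot (f : H) x : lo * `|f x| ^+ 2 <= kdot f f.
Proof. by have := kdot_ge f [fset x]%fset; rewrite /energy big_seq_fset1. Qed.

Lemma kdot_gt0 (f : H) : f != 0 -> 0 < kdot f f.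
Proof.
move=> f0; have [x fx0] : exists x, f x != 0.
  apply: contrapT => /forallNP f0'; move/negP: f0; apply.
  by apply/eqP/l2P => x; apply/eqP/negPn/negP/f0'.
rewrite (lt_le_trans _ (normsq_le_kdot f x))// mulr_gt0 ?kernel_lower_gt0//.
by rewrite exprn_gt0// normr_gt0.
Qed.

Lemma kdot_zmod_morphisml (g : H) : zmod_morphism (kdot ^~ g).
Proof. by move=> f f' /=; rewrite kdotDl -scaleN1r kdotZl mulN1r. Qed.

Lemma kdot_zmod_morphismr (f : H) : zmod_morphism (kdot f).
Proof.
move=> g g'; rewrite kdotC kdot_zmod_morphisml rmorphB/=.
by rewrite -!kdotC.
Qed.

Lemma kdot_scalabler (f : H) : scalable_for (Num.conj \; *%R) (kdot f).
Proof. by move=> a g; rewrite /= kdotC kdotZl rmorphM/= -kdotC. Qed.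

HB.instance Definition _ := isBilinear.Build C H H C *%R (Num.conj \; *%R) kdot
  kdot_zmod_morphisml kdot_zmod_morphismr (fun g a f => kdotZl a f g)
  kdot_scalabler.

Let kdot_hermitian (f g : H) : kdot f g = (-1) ^+ false * (kdot g f)^*.
Proof. by rewrite mul1r kdotC. Qed.

HB.instance Definition _ := isHermitianSesquilinear.Build C H false Num.conj
  kdot kdot_hermitian.

HB.instance Definition _ := isDotProduct.Build C H kdot kdot_gt0.

Definition knorm (f : H) : C := sqrtC (kdot f f).

Let knormD (f g : H) : knorm (f + g) <= knorm f + knorm g.
Proof. exact: (dot_triangle kdot). Qed.

Let knormZ a (f : H) : knorm (a *: f) = `|a| * knorm f.
Proof.
by rewrite /knorm (dnormZ kdot) sqrtCM ?nnegrE ?exprn_ge0 ?dnorm_ge0// sqrCK.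
Qed.

Let knorm_eq0 (f : H) : knorm f = 0 -> f = 0.
Proof. by move=> /eqP; rewrite sqrtC_eq0 (dnorm_eq0 kdot) => /eqP. Qed.

HB.instance Definition _ := Lmodule_isNormed.Build C H knormD knormZ knorm_eq0.

Lemma sqr_knorm (f : H) : `|f| ^+ 2 = kdot f f.
Proof. exact: sqrtCK. Qed.

End KernelSpace.

(** * Completeness of l^2 for the kernel norm *)

Section Completeness.
Variables (R : realType) (X : choiceType) (k : coercive_kernel R X).
Local Notation C := R[i].
Local Notation H := (kernel_l2 k).
Local Notation lo := (kernel_lower k).
Local Notation hi := (kernel_upper k).

Lemma eval_le_norm (f : H) x : sqrtC lo * `|f x| <= `|f|.
Proof.
have lo0 : 0 <= sqrtC lo by rewrite sqrtC_ge0; exact/ltW/kernel_lower_gt0.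
rewrite -(ler_pXn2r (ltn0Sn 1)) ?nnegrE ?mulr_ge0//.
by rewrite exprMn sqrtCK sqr_knorm normsq_le_kdot.
Qed.

(** Evaluation at [x] is Lipschitz for the kernel norm by [eval_le_norm], so the values of a Cauchy
    filter are Cauchy in each component. *)
Lemma kernel_l2_pointwise_cvg (F : set_system H) (FF : ProperFilter F) :
  cauchy F -> forall x, exists z, ccvg F (fun f : H => f x) z.
Proof.
move=> /cauchy_ballP Fc x.
have Fe (e : R) : 0 < e ->
    \forall f \near F & g \near F, `|(f : H) x - (g : H) x| < e%:C%C.
  move=> e0; have lo0 := kernel_lower_gt0 k.
  have := Fc (sqrtC lo * e%:C%C); rewrite mulr_gt0 ?sqrtC_gt0 ?ltcR// => /(_ isT).
  apply: filterS => -[f g] /=; rewrite -ball_normE /= => fg.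
  rewrite -(ltr_pM2l (x := sqrtC lo)) ?sqrtC_gt0//.
  exact: le_lt_trans (eval_le_norm (f - g) x) fg.
have cvgF (h : C -> R) : (forall z w, `|h z - h w|%:C%C <= `|z - w|) ->
    cvg ((fun f : H => h (f x)) @ F).
  move=> hl; apply/cauchy_cvgP/cauchy_ballP => e e0.
  rewrite near_map2; apply: filterS (Fe e e0) => -[f g] /= fg.
  by rewrite -ball_normE /= -ltcR (le_lt_trans (hl _ _)).
exists (Complex (lim ((fun f : H => complex.Re (f x)) @ F))
                (lim ((fun f : H => complex.Im (f x)) @ F))).
split; apply: cvgF => z w.
- by rewrite -raddfB normc_ge_Re.
- rewrite -raddfB -normrN -ReiNIm (le_trans (normc_ge_Re _))//.
  by rewrite normrM complexiE normCi mulr1.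
Qed.

(** The limit is the pointwise limit [phi]. The lower bound on the form turns the Cauchy condition
    into energy estimates uniform over finite sets, and the upper bound turns these back into norm
    convergence. *)
Lemma kernel_l2_complete (F : set_system H) :
  ProperFilter F -> cauchy F -> cvg F.
Proof.
move=> FF Fc; have lo0 := kernel_lower_gt0 k.
have /choice[phi Fphi] := kernel_l2_pointwise_cvg FF Fc.
(* For [g] within [e] of [f], coercivity bounds the energy of [f - g] on [E] by [e ^+ 2 / lo]; with
   [E] fixed, [g] then tends to [phi] pointwise. *)
have Fe (e : C) : 0 < e -> \forall f \near F, forall E : {fset X},
    energy (fun x => (f : H) x - phi x) E <= e ^+ 2 / lo.
  move=> e0; move/cauchy_ballP: Fc => /(_ e e0) /nearP_dep.
  apply: filterS => f Ff E.
  pose d (g : H) := energy (fun x => f x - g x) E.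
  have dphi : ccvg F d (energy (fun x => f x - phi x) E).
    rewrite /d /energy; apply: ccvg_sum => x.
    rewrite (_ : (fun t => _) =
      (fun g : H => (f x + (-1) * g x) * (f x + (-1) * g x)^*)).
      rewrite normCK -[- phi x]mulN1r; apply: ccvgM; last apply: ccvg_conj.
      - by apply: ccvgD; [exact: ccvg_cst|exact: ccvgZ (Fphi x)].
      - by apply: ccvgD; [exact: ccvg_cst|exact: ccvgZ (Fphi x)].
    by apply/funext => g; rewrite normCK mulN1r.
  apply: ccvg_le dphi; apply: filterS Ff => g.
  rewrite -ball_normE /= => fg.
  rewrite ler_pdivlMr// mulrC (le_trans (kdot_ge (f - g) E))// -sqr_knorm.
  by rewrite ler_pXn2r ?nnegrE// ltW.
have phil2 : phi \in @l2_pred R X.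
  have [f] := filter_ex (Fe 1 ltr01) => Ef.
  have df : (fun x => f x - phi x) \in @l2_pred R X by apply/asboolP; eexists.
  (* Any one [f] at bounded energy distance from [phi] suffices, l^2 being a subspace. *)
  rewrite (_ : phi = l2fun f - (fun x => f x - phi x)).
    by rewrite rpredB// l2funP.
  by apply/funext => x; rewrite [RHS]subKr.
apply/cvg_ex; exists (L2 phil2 : H); apply/cvgrPdist_le => e e0.
have h1 : 0 < `|hi| + 1 :> C by rewrite ltr_wpDl.
(* Chosen so that [|hi| * (d ^+ 2 / lo)] is [e ^+ 2 * |hi| / (|hi| + 1)]; the added 1 keeps the
   denominator positive. *)
pose d : C := e * sqrtC (lo / (`|hi| + 1)).
have d0 : 0 < d by rewrite mulr_gt0// sqrtC_gt0 divr_gt0.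
have := Fe d d0; apply: filterS => f fE.
rewrite distrC -(ler_pXn2r (ltn0Sn 1)) ?nnegrE ?(ltW e0)// sqr_knorm.
rewrite (le_trans (kdot_le (f := f - L2 phil2) fE))//.
rewrite exprMn sqrtCK [_ * (lo / _)]mulrCA [lo * _]mulrC mulfK ?gt_eqF//.
by rewrite mulrCA ler_piMr ?exprn_ge0 ?(ltW e0)// ler_pdivrMr// mul1r lerDl.
Qed.

HB.instance Definition _ := Uniform_isComplete.Build H kernel_l2_complete.

Definition kernel_hilbert : hilbertSpace R :=
  @HilbertSpace R H (@kdot R X k) (@sqr_knorm R X k).

End Completeness.

(** * Point masses and their inner products *)

Section Delta.
Variables (R : realType) (X : choiceType).
Local Notation C := R[i].

Lemma delta_l2 (a : X) : (fun x => (x == a)%:R) \in @l2_pred R X.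
Proof.
apply/asboolP; exists 1 => F; rewrite /energy.
have [aF|aF] := boolP (a \in F).
  rewrite (bigD1_seq a)//= eqxx normr1 expr1n big1 ?addr0// => x /negPf->.
  by rewrite normr0 expr0n.
rewrite big_seq big1 ?ler01// => x xF; case: eqP => [xa|_].
  by rewrite xa (negPf aF) in xF.
by rewrite normr0 expr0n.
Qed.

Definition delta (a : X) : l2 R X := L2 (delta_l2 a).

(** The finite form is exactly [k a b] as soon as the finite set contains both points. *)
Lemma kdot_delta (k : coercive_kernel R X) (a b : X) :
  kdot (delta a : kernel_l2 k) (delta b) = k a b.
Proof.
apply: kdot_unique; apply: ccvg_near (@ccvg_cst _ _ (@fset_ultrafilter X) _ (k a b)).
near=> F; have aF : a \in F.
  by near: F; apply: filterS (near_fset_ultrafilter [fset a]%fset) => F; apply;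
    rewrite in_fset1.
have bF : b \in F.
  by near: F; apply: filterS (near_fset_ultrafilter [fset b]%fset) => F; apply;
    rewrite in_fset1.
rewrite /finite_form (bigD1_seq a)//= [X in _ + X]big1 ?addr0; last first.
  by move=> x /negPf->; rewrite big1// => y _; rewrite mulr0 mul0r.
rewrite (bigD1_seq b)//= big1 ?addr0 => [|y /negPf->]; last first.
  by rewrite conjC0 mulr0.
by rewrite !eqxx conjC1 !mulr1.
Unshelve. all: by end_near. Qed.

End Delta.

(** * The left translation representation *)

Section Translation.
Variables (R : realType) (G : groupType) (k : coercive_kernel R G).
Local Notation C := R[i].
Local Notation H := (kernel_l2 k).
Local Notation lo := (kernel_lower k).
Local Notation hi := (kernel_upper k).

Lemma energy_translate (g : G) (f : G -> C) (F : {fset G}) :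
  energy (fun x => f (g^-1 * x)%g) F =
  energy f [fset (g^-1 * x)%g | x in F]%fset.
Proof. by rewrite /energy big_imfset//= => x y _ _ /mulgI. Qed.

Lemma translate_l2 (g : G) (f : l2 R G) :
  (fun x => f (g^-1 * x)%g) \in @l2_pred R G.
Proof.
have [B fB] := l2_bound f; apply/asboolP; exists B => F.
by rewrite energy_translate.
Qed.

Definition translate (g : G) (f : H) : H := L2 (translate_l2 g f).

Let translate_linear g : linear (translate g).
Proof. by move=> a f f'; apply/l2P. Qed.

HB.instance Definition _ g := GRing.isLinear.Build C H H *:%R (translate g)
  (translate_linear g).

Lemma translateM g h (f : H) : translate (g * h)%g f = translate g (translate h f).
Proof. by apply/l2P => x /=; rewrite invgM mulgA. Qed.

Lemma translate1 (f : H) : translate 1%g f = f.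
Proof. by apply/l2P => x /=; rewrite invg1 mul1g. Qed.

Lemma translate_delta g h : translate g (delta R h) = delta R (g * h)%g.
Proof.
apply/l2P => x /=; congr (_%:R); congr nat_of_bool.
by rewrite -(inj_eq (@mulgI _ g)) mulKVg.
Qed.

(** Translation only permutes the values of [f], preserving energy bounds; comparing energy with the
    form from both sides costs the factor [|hi| / lo], independent of [g]. *)
Lemma sqr_norm_translate g (f : H) :
  `|translate g f| ^+ 2 <= `|hi| / lo * `|f| ^+ 2.
Proof.
rewrite !sqr_knorm -mulrA [_^-1 * _]mulrC; apply: kdot_le => F /=.
rewrite energy_translate ler_pdivlMr ?kernel_lower_gt0// mulrC.
exact: kdot_ge.
Qed.

Local Notation rep_bound := (1 + complex.Re (`|hi| / lo)).

Lemma op_norm_translate g :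
  (op_norm (H := kernel_hilbert k) (translate g) <= rep_bound%:E)%E.
Proof.
have lo0 := kernel_lower_gt0 k.
apply: ub_ereal_sup => _ [f /= f1 <-]; rewrite lee_fin -lecR.
have q0 : 0 <= `|hi| / lo by rewrite divr_ge0// ltW.
rewrite rmorphD/= RRe_real ?normr_real// RRe_real ?ger0_real//.
have Tf : `|translate g f| ^+ 2 <= `|hi| / lo.
  rewrite (le_trans (sqr_norm_translate g f))// ler_piMr//.
  by rewrite exprn_ile1.
(* This inequality passes from squared norms to norms without a square root in the bound. *)
have t1 (t : C) : 0 <= t -> t <= 1 + t ^+ 2.
  move=> t0; rewrite -subr_ge0 (_ : _ - t = (1 - t) * (1 - t) + t); last by ring.
  rewrite addr_ge0// -expr2 real_exprn_even_ge0// rpredB ?rpred1//.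
  exact: ger0_real.
by rewrite (le_trans (t1 _ _))// lerD2l.
Qed.

Lemma op_norm_translate_lty g :
  (op_norm (H := kernel_hilbert k) (translate g) < +oo)%E.
Proof. exact: le_lt_trans (op_norm_translate g) (ltry _). Qed.

Lemma translate_invertible g :
  bounded_invertible (H := kernel_hilbert k) (translate g).
Proof.
split; first exact: op_norm_translate_lty.
exists (translate g^-1%g); split; first exact: op_norm_translate_lty.
- by move=> f; rewrite /= -translateM mulVg translate1.
- by move=> f; rewrite /= -translateM mulgV translate1.
Qed.

Definition translation_rep : representation G (kernel_hilbert k) :=
  @Representation R G (kernel_hilbert k) translate translate_invertible
    translateM.

Lemma translation_rep_uniformly_bounded : uniformly_bounded translation_rep.
Proof.
apply: (@le_lt_trans _ _ rep_bound%:E); last exact: ltry.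
by apply: ub_ereal_sup => _ [g _ <-]; exact: op_norm_translate.
Qed.

End Translation.

(** * Positive definite kernels and their diagonal perturbation *)

Section PositiveDefinite.
Variables (R : realType) (X : choiceType) (K : X -> X -> R[i]).

Lemma fsbig_finite_form (F : {fset X}) (f : X -> R[i]) :
  (forall x, x \notin F -> f x = 0) ->
  \sum_(x \in [set: X]) \sum_(y \in [set: X]) K x y * f x * (f y)^* =
  finite_form K F f f.
Proof.
move=> fF; rewrite (fsbigTE F) => [|x xF]; last first.
  by apply: fsbig1 => y _; rewrite fF// mulr0 mul0r.
apply: eq_bigr => x _; rewrite (fsbigTE F)// => y yF.
by rewrite (fF y)// conjC0 mulr0.
Qed.

Lemma positive_definiteP : positive_definite_kernel K <->
  (forall (F : {fset X}) f, 0 <= finite_form K F f f).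
Proof.
split=> [Kpos F f|Kpos f /finite_fsetP[F fF]].
(* Cutting [f] off outside [F] gives finite support and leaves the finite form unchanged. *)
- pose f' x := if x \in F then f x else 0.
  have f'F x : x \notin F -> f' x = 0 by rewrite /f' => /negPf->.
  have -> : finite_form K F f f = finite_form K F f' f'.
    rewrite /finite_form big_seq [RHS]big_seq; apply: eq_bigr => x xF.
    rewrite big_seq [RHS]big_seq; apply: eq_bigr => y yF.
    by rewrite /f' xF yF.
  rewrite -fsbig_finite_form//; apply: Kpos.
  apply: (sub_finite_set (B := [set` F])) => // x /=.
  by apply: contraNT => /f'F->.
- rewrite (fsbig_finite_form (F := F))// => x; apply: contraNeq => fx.
  by have : [set x | f x != 0] x by []; rewrite fF.
Qed.

(** The term [c] on the diagonal adds [c] times the energy to a nonnegative form, whence coercivity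
    with constant [c / (1 + c)]. Dividing by [1 + c] restores the value 1 on the diagonal when [K]
    has it there. *)
Lemma perturbed_kernel (c N : R[i]) : 0 < c -> hermitian_kernel K ->
  positive_definite_kernel K ->
  (forall x (F : {fset X}), \sum_(y <- F) `|K x y| <= N) ->
  exists k : coercive_kernel R X,
    forall x y, k x y = (K x y + c * (x == y)%:R) / (1 + c).
Proof.
move=> c0 Kherm /positive_definiteP Kpos KN.
pose k x y := (K x y + c * (x == y)%:R) / (1 + c).
have c1 : 0 < 1 + c by rewrite addr_gt0.
have kherm : hermitian_kernel k.
  have cR : c \is Num.real by rewrite ger0_real// ltW.
  have c1R : (1 + c)^-1 \is Num.real by rewrite rpredV ger0_real// ltW.
  move=> x y; rewrite /k rmorphM rmorphD rmorphM/= -Kherm conjC_nat eq_sym.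
  by rewrite !conj_Creal.
have klo f (F : {fset X}) :
    c / (1 + c) * energy f F <= finite_form k F f f.
  rewrite [leRHS](_ : _ = (finite_form K F f f + c * energy f F) / (1 + c)).
    by rewrite mulrAC ler_pM2r ?invr_gt0// lerDr.
  rewrite /finite_form /energy [c * _]mulr_sumr -big_split/= mulr_suml.
  apply: eq_big_seq => x xF.
  (* The diagonal entry is split off, as it alone receives the perturbation. *)
  rewrite /k (bigD1_seq x)//= [in RHS](bigD1_seq x)//= eqxx normCK.
  rewrite [X in _ + X](_ : _ =
      (\sum_(y <- F | y != x) K x y * f x * (f y)^*) / (1 + c)).
    by rewrite mulr1; ring.
  rewrite mulr_suml; apply: eq_bigr => y /negPf xy.
  by rewrite eq_sym xy mulr0 addr0; ring.
have khi x (F : {fset X}) : \sum_(y <- F) `|k x y| <= N + c.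
  have cF : \sum_(y <- F) c * (x == y)%:R <= c.
    have [xF|xF] := boolP (x \in F).
      rewrite (bigD1_seq x)//= eqxx mulr1 big1 ?addr0// => y /negPf.
      by rewrite eq_sym => ->; rewrite mulr0.
    rewrite big_seq big1 ?ltW// => y yF; case: eqP => [xy|_]; last by rewrite mulr0.
    by rewrite xy yF in xF.
  rewrite (le_trans _ (lerD (KN x F) cF))// -big_split/=; apply: ler_sum => y _.
  rewrite /k normrM normfV (gtr0_norm c1) ler_pdivrMr//.
  rewrite (le_trans (ler_normD _ _))//.
  rewrite [X in _ + X <= _]ger0_norm ?mulr_ge0 ?ler0n ?(ltW c0)//.
  by rewrite ler_peMr ?lerDl ?(ltW c0)// addr_ge0// mulr_ge0 ?ler0n// ltW.
by exists (CoerciveKernel (divr_gt0 c0 c1) kherm klo khi).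
Qed.

End PositiveDefinite.

(** * Finiteness of balls in the word metric *)

Section WordBalls.
Variables (G : groupType) (A : set G).
Hypotheses (finA : finite_set A) (genA : generates A).

(** A word of size [n.+1] is a letter from the finite set of generators and inverses followed by a
    word of size [n]. *)
Lemma finite_word_of_size n : finite_set [set g | word_of_size A g n].
Proof.
elim: n => [|n IH].
  apply: (sub_finite_set (B := [set 1%g])) => [g [w [/eqP]]|//].
  by rewrite size_eq0 => /eqP-> _ <-; rewrite big_nil.
have finA' : finite_set (A `|` [set s^-1%g | s in A]).
  by rewrite finite_setU; split=> //; exact: finite_image.
apply: sub_finite_set (finite_image2 (fun g h => g * h)%g finA' IH).
move=> g [[|s w] [//= [sw] wA <-]]; rewrite big_cons.
exists s.
  have [sA|sA] := wA s (mem_head _ _); [by left|right].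
  by exists s^-1%g; rewrite ?invgK.
exists (\big[*%g/1%g]_(t <- w) t)%g => //; exists w; split=> // t tw.
by apply: wA; rewrite inE tw orbT.
Qed.

Lemma finite_word_ball n : finite_set [set g | (word_length genA g < n)%N].
Proof.
apply: sub_finite_set (bigcup_finite (finite_II n)
  (fun i _ => finite_word_of_size i)) => g gn.
by exists (word_length genA g) => //; exact: word_lengthP.
Qed.

(** Translating by [x^-1] carries the support of row [x] into one fixed ball, whose cardinality
    bounds every row sum. *)
Lemma word_ball_row_sum (R : realType) (K : G -> G -> R[i]) n :
  (forall x y, `|K x y| <= 1) ->
  (forall x y, (n <= word_length genA (x^-1 * y)%g)%N -> K x y = 0) ->
  exists N, forall x (F : {fset G}), \sum_(y <- F) `|K x y| <= N.
Proof.
move=> K1 K0; have /finite_fsetP[B Bn] := finite_word_ball n.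
exists (size B)%:R => x F.
rewrite (bigID (fun y => (x^-1 * y)%g \in B))/= [X in _ + X]big1 ?addr0.
  rewrite (le_trans (ler_sum _ (fun y _ => K1 x y)))// -big_filter.
  rewrite big_const_seq count_predT iter_addr_0 ler_nat.
  rewrite -(size_map (fun y => x^-1 * y)%g) uniq_leq_size//.
    by rewrite map_inj_uniq ?filter_uniq ?fset_uniq//; exact: mulgI.
  by move=> z /mapP[y]; rewrite mem_filter => /andP[yB _] ->.
move=> y yB; rewrite K0 ?normr0// leqNgt; apply: contra yB => yn.
by have : [set g | (word_length genA g < n)%N] (x^-1 * y)%g by []; rewrite Bn.
Qed.

End WordBalls.

(** * Gram kernels and their Schur products *)

Section GramKernels.
Variables (R : realType) (X : choiceType) (U : lmodType R[i]).
Local Notation C := R[i].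
Variable form : {dot U for @Num.conj C}.
Local Notation "''[' u , v ]" := (form u v) : ring_scope.

Lemma gram_conj_ge0 (u : X -> U) (s : seq X) (f : X -> C) :
  0 <= finite_form (fun x y => '[u x, u y]^*) s f f.
Proof.
pose w := \sum_(x <- s) (f x)^* *: u x.
suff -> : finite_form (fun x y => '[u x, u y]^*) s f f = '[w, w]^*.
  by rewrite conjC_ge0 dnorm_ge0.
rewrite /w linear_sumlz rmorph_sum; apply: eq_bigr => x _.
rewrite linear_sumr rmorph_sum; apply: eq_bigr => y _ /=.
by rewrite linearZl_LR linearZr_LR /= !rmorphM/= !conjCK; ring.
Qed.

(* One step of Gram-Schmidt at [u a] splits off a rank-one kernel and makes the
   new vector at [a] vanish. *)
Lemma gram_schur_ge0 (M : X -> X -> C) :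
  (forall s f, 0 <= finite_form M s f f) ->
  forall s (u : X -> U) f,
    0 <= finite_form (fun x y => '[u x, u y] * M x y) s f f.
Proof.
move=> Mpos; elim=> [|a s IH] u f; first by rewrite /finite_form big_nil.
(* If [w = 0], the inverse of ['[w, w]] is 0 by convention and [u'] is [u], so the decomposition
   below still holds. *)
pose w := u a; pose u' x := u x - ('[u x, w] / '[w, w]) *: w.
have u'a0 : u' a = 0.
  rewrite /u' -/w; have [->|w0] := eqVneq w 0; first by rewrite scaler0 subr0.
  by rewrite divff ?scale1r ?subrr// dnorm_eq0.
have u'E x y : '[u x, u y] = '[w, w]^-1 * ('[u x, w] * '[u y, w]^*) + '[u' x, u' y].
  have [w0|w0] := eqVneq w 0.
    by rewrite /u' w0 !scaler0 !subr0 !linear0r mul0r mulr0 add0r.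
  have ww0 : '[w, w] != 0 by rewrite dnorm_eq0.
  have wR : '[w, w]^* = '[w, w] by rewrite conj_Creal// ger0_real// dnorm_ge0.
  have yw : '[w, u y] = '[u y, w]^* by rewrite hermC mul1r.
  rewrite /u' linearBl !linearBr !linearZl_LR !linearZr_LR/= yw fmorph_div/= wR.
  by field.
(* The rank-one factor is absorbed into the test function, leaving a form of [M] itself. *)
have -> : finite_form (fun x y => '[u x, u y] * M x y) (a :: s) f f =
    '[w, w]^-1 * finite_form M (a :: s) (fun x => f x * '[u x, w])
      (fun x => f x * '[u x, w]) +
    finite_form (fun x y => '[u' x, u' y] * M x y) (a :: s) f f.
  rewrite /finite_form mulr_sumr -big_split; apply: eq_bigr => x _ /=.
  rewrite mulr_sumr -big_split; apply: eq_bigr => y _ /=.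
  by rewrite u'E rmorphM/=; ring.
rewrite addr_ge0//; first by rewrite mulr_ge0// invr_ge0 dnorm_ge0.
(* Since [u' a = 0], row and column [a] vanish and the induction hypothesis applies to [u'] on
   [s]. *)
rewrite [X in 0 <= X](_ : _ = finite_form (fun x y => '[u' x, u' y] * M x y) s f f)//.
rewrite /finite_form big_cons big1 ?add0r => [|y _]; last first.
  by rewrite u'a0 linear0l !mul0r.
by apply: eq_bigr => x _; rewrite big_cons u'a0 linear0r !mul0r add0r.
Qed.

End GramKernels.

(** * Unit vectors varying slowly along the word metric *)

Section UnitVectorFamily.
Variables (R : realType) (H : hilbertSpace R) (G : groupType) (A : set G).
Hypothesis genA : generates A.
Variables (p : G -> H) (eta : R[i]).
Local Notation "''[' u , v ]" := (inner H u v) : ring_scope.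
Hypotheses (eta_ge0 : 0 <= eta) (normp : forall g, `|p g| = 1).
Hypothesis p_gen : forall g h, (word_length genA (g^-1 * h)%g <= 1)%N ->
  `|1 - '[p g, p h]| <= eta ^+ 2 / 2.

Lemma norm_innerE (v : H) : `|v| = sqrtC '[v, v].
Proof. by rewrite -sqr_norm_inner sqrCK. Qed.

Lemma inner_unit g : '[p g, p g] = 1.
Proof. by rewrite -sqr_norm_inner normp expr1n. Qed.

(** For unit vectors the squared distance is [2 * 'Re (1 - z)], with [z] their inner product; this
    explains the tolerance [eta ^+ 2 / 2]. *)
Lemma norm_gen_step g h : (word_length genA (g^-1 * h)%g <= 1)%N ->
  `|p g - p h| <= eta.
Proof.
move=> gh; rewrite -(ler_pXn2r (ltn0Sn 1)) ?nnegrE// sqr_norm_inner dnormB.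
rewrite !inner_unit; set z := '[p g, p h].
rewrite (_ : _ - _ = 2 * 'Re (1 - z)); last first.
  by rewrite ReE rmorphB rmorph1/=; field.
rewrite (@le_trans _ _ (2 * `|1 - z|))//.
  by rewrite ler_pM2l//; case: (leif_Re_Creal (1 - z)).
by rewrite mulrC -ler_pdivlMr// p_gen.
Qed.

(** Telescoping along a shortest word leading from [g] to [h], each letter costing at most [eta]. *)
Lemma norm_word_step g h :
  `|p g - p h| <= (word_length genA (g^-1 * h)%g)%:R * eta.
Proof.
have [w [<- wA wE]] := word_lengthP genA (g^-1 * h)%g.
rewrite (_ : h = g * \big[*%g/1%g]_(s <- w) s)%g; last by rewrite wE mulKVg.
elim: w g wA {wE h} => [|s w IH] g wA.
  by rewrite big_nil mulg1 subrr normr0 mul0r.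
rewrite big_cons mulgA -(subrK (p (g * s)%g) (p g)) -addrA.
rewrite (le_trans (ler_normD _ _))// mulrS mulrDl mul1r lerD//.
  apply: norm_gen_step; rewrite mulKg; apply: word_length_min.
  exists [:: s]; split; rewrite ?big_seq1// => t.
  by rewrite inE => /eqP->; apply: wA; rewrite mem_head.
by apply: IH => t tw; apply: wA; rewrite inE tw orbT.
Qed.

Lemma norm_inner_le1 g h : `|'[p g, p h]| <= 1.
Proof.
rewrite (le_trans (dot_CauchySchwarz_sqrt (inner H) _ _))//.
by rewrite -!norm_innerE !normp mulr1.
Qed.

(** Write [1 - |z|^2] as [(1 - z) + z * (1 - z)^*] with [|z| <= 1], and [1 - z] as the inner product
    of [p g] with [p g - p h]. *)
Lemma inner_word_step g h : `|1 - `|'[p g, p h]| ^+ 2| <=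
  2 * ((word_length genA (g^-1 * h)%g)%:R * eta).
Proof.
set z := '[p g, p h].
have z1 : `|1 - z| <= (word_length genA (g^-1 * h)%g)%:R * eta.
  rewrite -[X in `|X - z|](inner_unit g) /z -linearBr (le_trans _ (norm_word_step g h))//.
  rewrite (le_trans (dot_CauchySchwarz_sqrt (inner H) _ _))//.
  by rewrite -!norm_innerE normp mul1r.
rewrite (_ : 1 - _ = (1 - z) + z * (1 - z)^*); last first.
  by rewrite normCK rmorphB rmorph1/=; ring.
rewrite (le_trans (ler_normD _ _))// mulrDl mul1r lerD//.
by rewrite normrM norm_conjC (le_trans _ z1)// ler_piMl// norm_inner_le1.
Qed.

End UnitVectorFamily.

(** * The two implications of the characterization *)

Theorem theorem1 (R : realType) (G : groupType) (A : set G)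
    (finA : finite_set A) (genA : generates A) :
  group_property_A R genA <->
  (forall eps : R, 0 < eps ->
   exists (H : hilbertSpace R) (pi : representation G H) (v : H) (S : R),
     [/\ uniformly_bounded pi, 0 < S,
         forall g : G, `|pi g v| = 1,
         forall g h : G, (word_length genA (g^-1 * h)%g <= 1)%N ->
           `|1 - inner H (pi g v) (pi h v)| <= (eps%:C)%C &
         forall g h : G, S <= (word_length genA (g^-1 * h)%g)%:R ->
           inner H (pi g v) (pi h v) = 0]).
Proof.
split=> [propA eps eps0|rep r eps r0 eps0].
- have e20 : 0 < eps / 2 by rewrite divr_gt0.
  (* Radius 1 is all that condition (2) asks for; half of [eps] goes to [K], the other half to the
     perturbation [c]. *)
  have [K [S [[Kherm Kpos K01 S0] [K1 Keps KS]]]] := propA 1 (eps / 2) ltr01 e20.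
  have nK (x y : G) : `|K x y| <= 1.
    by have /andP[K0 ?] := K01 x y; rewrite ger0_norm.
  pose n := (Num.truncn S).+1.
  have nS : S <= n%:R by apply/ltW; exact: truncnS_gt.
  have [N KN] := word_ball_row_sum finA nK (fun x y xy => KS x y
    (le_trans nS (etrans (ler_nat _ _ _) xy))).
  pose c : R[i] := (eps / 2)%:C%C.
  have c0 : 0 < c by rewrite ltcR.
  have [k kE] := perturbed_kernel c0 (Kherm : @hermitian_kernel R G K) Kpos KN.
  have c1 : 0 < 1 + c by rewrite addr_gt0.
  have kdelta g h : inner (kernel_hilbert k) (translation_rep k g (delta R 1%g))
      (translation_rep k h (delta R 1%g)) = k g h.
    by rewrite /= !translate_delta !mulg1; exact: kdot_delta.
  have kxx g : k g g = 1 by rewrite kE K1 eqxx mulr1 divff// gt_eqF.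
  exists (kernel_hilbert k), (translation_rep k), (delta R 1%g), S.
  split=> //; first exact: translation_rep_uniformly_bounded.
  + by move=> g; rewrite norm_innerE kdelta kxx sqrtC1.
  + move=> g h gh; rewrite kdelta.
    (* On the diagonal [k] is exactly 1; off it the perturbation term is 0 and only the division by
       [1 + c] matters. *)
    have [<-|gNh] := eqVneq g h; first by rewrite kxx subrr normr0 ler0c ltW.
    rewrite kE (negPf gNh) mulr0 addr0.
    rewrite (_ : 1 - _ = ((1 - K g h) + c) / (1 + c)); last first.
      have c1N : 1 + c != 0 by rewrite gt_eqF.
      by rewrite -[X in X - _](divff c1N) -mulrBl addrAC.
    rewrite normrM normfV (gtr0_norm c1) ler_pdivrMr//.
    rewrite (le_trans (ler_normD _ _))// (gtr0_norm c0).
    have gh1 : mdist (g : word_space R genA) h <= 1 by rewrite mdist_wordE lern1.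
    rewrite (le_trans (lerD (Keps _ _ gh1) (lexx _)))//.
    rewrite -rmorphD/= -splitr ler_peMr ?ler0c ?(ltW eps0)//.
    by rewrite lerDl ltW.
  + move=> g h gh; rewrite kdelta kE KS// add0r.
    (* The diagonal term could survive only at distance 0, which [0 < S] excludes. *)
    case: eqP => [gh1|_]; last by rewrite mulr0 mul0r.
    by move: gh; rewrite gh1 mulVg word_length1 leNgt S0.
(* Makes the bound [2 * (r * eta)] of [inner_word_step] at distance [r] equal to [eps]. *)
- pose eta := eps / (2 * r).
  have eta0 : 0 < eta by rewrite divr_gt0// mulr_gt0.
  have etaC0 : 0 <= eta%:C%C by rewrite ler0c ltW.
  have [] := rep (eta ^+ 2 / 2); first by rewrite divr_gt0// exprn_gt0.
  move=> H [pi [v [S [_ S0 nv v1 vS]]]].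
  have p1 g h : (word_length genA (g^-1 * h)%g <= 1)%N ->
      `|1 - inner H (pi g v) (pi h v)| <= eta%:C%C ^+ 2 / 2.
    move=> /v1; rewrite fmorph_div/= rmorphXn/= rmorph_nat; exact.
  pose L g h := inner H (pi g v) (pi h v).
  (* The squared modulus takes values in [0,1], whereas [L] is only complex-valued; it keeps the
     zeros of [L]. *)
  exists (fun g h => L g h * (L g h)^*), S; split; split=> //.
  + by move=> g h; rewrite rmorphM/= /L hermC mul1r; ring.
  + apply/positive_definiteP => F f.
    exact: gram_schur_ge0 (gram_conj_ge0 (inner H) (fun g => pi g v)) _ _ _.
  + move=> g h; rewrite -normCK exprn_ge0//=.
    by rewrite exprn_ile1// (norm_inner_le1 nv).
  + by move=> g; rewrite /L (inner_unit nv) conjC1 mulr1.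
  + move=> g h gh; rewrite -normCK.
    rewrite (le_trans (inner_word_step etaC0 nv p1 g h))//.
    move: gh; rewrite mdist_wordE => gh.
    rewrite -!(rmorph_nat (real_complex R)).
    rewrite -!rmorphM/= lecR mulrCA.
    have e20 : 0 <= 2 * eta by rewrite mulr_ge0// ltW.
    rewrite (le_trans (ler_wpM2r e20 gh))//.
    by rewrite /eta le_eqVlt; apply/orP; left; apply/eqP; field; rewrite gt_eqF.
  + by move=> g h gh; rewrite /L vS// mul0r.
Qed.
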